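(* Let $1\to N\to G\xrightarrow{q}\Gamma\to1$ be a short exact sequence of groups. Assume that it splits (i.e. there is a homomorphism $s\colon\Gamma\to G$ with $q\circ s=\mathrm{id}_\Gamma$) and that $N$ is abelian. Then for every $x\in[G,N]$, $$\mathrm{cl}_{G,N}(x)\le 2\,\mathrm{cl}_G(x).$$
   Context: $N$ is regarded as a normal subgroup of $G$. A mixed commutator is an element $[g,x]=gxg^{-1}x^{-1}$ with $g\in G$, $x\in N$; $[G,N]$ is the subgroup generated by mixed commutators, and for $x\in[G,N]$, $\mathrm{cl}_{G,N}(x)$ is the smallest integer $n\ge0$ such that $x$ is a product of $n$ mixed commutators. $\mathrm{cl}_G=\mathrm{cl}_{G,G}$ is the ordinary commutator length on $[G,G]$. *)

(* Defs.v *)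
From HB Require Import structures.
From mathcomp Require Import all_boot.
From mathcomp Require Import boolp classical_sets.

Set Implicit Arguments.
Unset Strict Implicit.
Unset Printing Implicit Defensive.

Local Open Scope classical_set_scope.
Local Open Scope group_scope.

(* A map of groups preserving products also preserves 1 and inverses, so
   {multiplicative _ -> _} is the type of group homomorphisms. *)
Definition short_exact (N G Gam : groupType)
    (i : {multiplicative N -> G}) (q : {multiplicative G -> Gam}) : Prop :=
  [/\ injective i, range i = q @^-1` [set 1] & range q = [set: Gam]].

(* The convention is [g, x] = g x g^-1 x^-1; MathComp's [~ g, x] is
   g^-1 x^-1 g x. *)
Definition mixed_commutators (G : groupType) (N : set G) : set G :=
  [set g * x * g^-1 * x^-1 | g in [set: G] & x in N].

Definition mixed_commutator_subgroup (G : groupType) (N : set G) : set G :=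
  smallest (fun A : set G => group_closed [in A]) (mixed_commutators N).

Definition mixed_commutator_product (G : groupType) (N : set G) (n : nat)
    (x : G) : Prop :=
  exists2 c : 'I_n -> G,
    forall i, mixed_commutators N (c i) & x = \prod_(i < n) c i.

(* The default value 0 is taken only when x is not a product of mixed
   commutators; see mixed_clP and clP. *)
Definition mixed_cl (G : groupType) (N : set G) (x : G) : nat :=
  xget 0%N [set n | mixed_commutator_product N n x /\
    forall m, mixed_commutator_product N m x -> (n <= m)%N].

Definition cl (G : groupType) (x : G) : nat := mixed_cl [set: G] x.

Section MixedCl.
Variable G : groupType.
Implicit Types (N : set G) (x y : G).

Lemma mixed_commutators_inv N x :
  group_closed [in N] -> mixed_commutators N x -> mixed_commutators N x^-1.
Proof.
move=> /group_closedV NV [g _ [y Ny <-]].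
exists (y * g * y^-1) => //; exists y^-1.
  by apply/set_mem/NV/mem_set.
by rewrite !invgM !invgK !mulgA !mulgVK.
Qed.

Lemma mixed_commutator_product1 N : mixed_commutator_product N 0 1.
Proof. by exists (fun=> 1) => [[]|] //; rewrite big_ord0. Qed.

Lemma mixed_commutator_productM N m n x y :
  mixed_commutator_product N m x -> mixed_commutator_product N n y ->
  mixed_commutator_product N (m + n) (x * y).
Proof.
move=> [c cN ->] [d dN ->].
exists (fun k => match split k with inl i => c i | inr j => d j end).
  by move=> k; case: split.
rewrite big_split_ord /=; congr (_ * _); apply: eq_bigr => k _.
  by rewrite -[lshift _ _]/(unsplit (inl k)) unsplitK.
by rewrite -[rshift _ _]/(unsplit (inr k)) unsplitK.
Qed.

Lemma mixed_commutator_productV N n x : group_closed [in N] ->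
  mixed_commutator_product N n x -> mixed_commutator_product N n x^-1.
Proof.
move=> Ng; elim: n x => [|n IHn] x [c cN ->].
  by rewrite big_ord0 invg1; apply: mixed_commutator_product1.
rewrite big_ord_recl invgM.
suff: mixed_commutator_product N (n + 1)
    ((\prod_(i < n) c (lift ord0 i))^-1 * (c ord0)^-1) by rewrite addn1.
apply: mixed_commutator_productM.
  by apply: IHn; exists (fun i => c (lift ord0 i)).
exists (fun=> (c ord0)^-1); last by rewrite big_ord1.
by move=> _; apply: mixed_commutators_inv.
Qed.

Lemma mixed_commutator_subgroupP N x : group_closed [in N] ->
  mixed_commutator_subgroup N x <-> exists n, mixed_commutator_product N n x.
Proof.
move=> Ng; split=> [Hx|[n [c cN ->]] A [Ag NA]].
  suff: [set y | exists n, mixed_commutator_product N n y] x by [].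
  apply: Hx; split=> [|y yN].
    split=> [|y z /set_mem[m ym] /set_mem[n zn]]; apply/mem_set.
      by exists 0%N; apply: mixed_commutator_product1.
    exists (m + n)%N; apply: mixed_commutator_productM => //.
    exact: mixed_commutator_productV.
  by exists 1%N, (fun=> y) => //; rewrite big_ord1.
apply/set_mem; have AM := group_closedM Ag.
elim/big_ind: _ => [|y z yA zA|k _]; first by case: Ag.
  exact: AM.
by apply/mem_set/NA.
Qed.

Lemma mixed_clP N x : group_closed [in N] -> mixed_commutator_subgroup N x ->
  mixed_commutator_product N (mixed_cl N x) x /\
  forall m, mixed_commutator_product N m x -> (mixed_cl N x <= m)%N.
Proof.
move=> Ng /(mixed_commutator_subgroupP _ Ng) [n0 Hn0].
have ex : exists n, `[< mixed_commutator_product N n x >].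
  by exists n0; apply/asboolP.
pose S := [set n | mixed_commutator_product N n x /\
  forall m, mixed_commutator_product N m x -> (n <= m)%N].
apply: (@xgetPex _ 0%N S); case: (ex_minnP ex) => n /asboolP Hn Hmin.
by exists n; split=> // m Hm; apply/Hmin/asboolP.
Qed.

Lemma clP N x : mixed_commutator_subgroup N x ->
  mixed_commutator_product [set: G] (cl x) x /\
  forall m, mixed_commutator_product [set: G] m x -> (cl x <= m)%N.
Proof.
move=> Hx; apply: mixed_clP.
  by split=> [|y z _ _]; apply/mem_set.
move=> A [Ag GA]; apply: Hx; split=> // y [g _ [z _ <-]].
by apply: GA; exists g => //; exists z.
Qed.

End MixedCl.

(* Main.v *)
Require Import Defs.
From HB Require Import structures.
From mathcomp Require Import all_boot.
From mathcomp Require Import boolp classical_sets.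

Local Open Scope classical_set_scope.
Local Open Scope group_scope.

(** Put [t = s \o q], an idempotent endomorphism of [G] with kernel [N].  For
    [g = a * t g] and [h = b * t h] with [a], [b] in [N], expanding [[g, h]] and
    commuting one pair of factors in the abelian group [N] shows that
    [[g, h] * (t [g, h])^-1] is a product of two mixed commutators.  Since mixed
    commutators are stable under conjugation, the factors [t [g_k, h_k]] of a
    product of [n] commutators [x] can be gathered at the right, so that
    [x * (t x)^-1] is a product of [2 * n] mixed commutators; and [t x = 1] when
    [x] is in [[G, N]]. *)

Lemma multiplicative1 (G H : groupType) (f : {multiplicative G -> H}) :
  f 1 = 1.
Proof. by apply: (mulgI (f 1)); rewrite -gmulfM !mulg1. Qed.

Lemma multiplicativeV (G H : groupType) (f : {multiplicative G -> H}) (x : G) :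
  f x^-1 = (f x)^-1.
Proof.
by apply: (mulgI (f x)); rewrite -gmulfM !mulgV; apply: multiplicative1.
Qed.

Section NormalSet.
Variables (G : groupType) (N : set G).
Hypothesis normal_N : forall g y : G, N y -> N (g * y * g^-1).

Lemma mixed_commutators_conj (g y : G) :
  mixed_commutators N y -> mixed_commutators N (g * y * g^-1).
Proof.
move=> [h _ [z Nz <-]]; exists (g * h * g^-1) => //.
exists (g * z * g^-1); first exact: normal_N.
by rewrite !invgM !invgK !mulgA !mulgVK.
Qed.

Lemma mixed_commutator_product_conj (n : nat) (g y : G) :
  mixed_commutator_product N n y -> mixed_commutator_product N n (g * y * g^-1).
Proof.
move=> [c cN ->]; exists (fun k => g * c k * g^-1).
  by move=> k; apply: mixed_commutators_conj.
elim/big_rec2: _ => [|k u v _ <-]; first by rewrite mulg1 mulgV.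
by rewrite !mulgA mulgVK.
Qed.

Hypothesis group_N : group_closed [in N].
Hypothesis abelian_N : forall a b : G, N a -> N b -> commute a b.
Variable t : {multiplicative G -> G}.
Hypothesis retract_t : forall g : G, N (g * (t g)^-1).

Lemma commutator_mod_retract (g h : G) :
  let k := g * h * g^-1 * h^-1 in mixed_commutator_product N 2 (k * (t k)^-1).
Proof.
move=> k; set a := g * (t g)^-1; set b := h * (t h)^-1.
(* Substituting [g = a * t g], [h = b * t h] in [k] and moving the values of [t] to the right
   conjugates [b], [a^-1], [b^-1] in turn; [b'], [u], [v] record this: [k * (t k)^-1] is [a * b' *
   (u * a^-1 * u^-1) * (v * b'^-1 * v^-1)]. *)
pose b' := t g * b * (t g)^-1.
pose u := t g * t h * (t g)^-1; pose v := u * (t h)^-1 * (t g)^-1.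
have Na : N a by apply: retract_t.
have Nb' : N b' by apply/normal_N/retract_t.
(* With the element of [N] in the first slot, this is the inverse of a mixed commutator. *)
have mixedV w y : N y -> mixed_commutator_product N 1 (y * w * y^-1 * w^-1).
  move=> Ny; have -> : y * w * y^-1 * w^-1 = (w * y * w^-1 * y^-1)^-1.
    by rewrite !invgM !invgK !mulgA.
  apply: mixed_commutator_productV => //.
  exists (fun=> w * y * w^-1 * y^-1); last by rewrite big_ord1.
  by move=> _; exists w => //; exists y.
suff -> : k * (t k)^-1 = (a * u * a^-1 * u^-1) * (b' * v * b'^-1 * v^-1).
  by rewrite -[2%N]/(1 + 1)%N; apply: mixed_commutator_productM; apply: mixedV.
have NaV : N (u * a^-1 * u^-1).
  by apply: normal_N; apply/set_mem/(group_closedV group_N)/mem_set.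
transitivity (a * (b' * (u * a^-1 * u^-1)) * (v * b'^-1 * v^-1)).
  rewrite /k !gmulfM !multiplicativeV /b' /v /u /a /b !invgM !invgK !mulgA.
  by rewrite !(mulgVK, mulgK).
by rewrite (abelian_N _ _ Nb' NaV) !mulgA.
Qed.

(** The map sending [x] to [x * (t x)^-1] is a crossed homomorphism: splitting off the first
    commutator only conjugates the remaining factor by [t k], which keeps its length. *)
Lemma commutator_product_mod_retract (n : nat) (x : G) :
  mixed_commutator_product [set: G] n x ->
  mixed_commutator_product N (2 * n) (x * (t x)^-1).
Proof.
elim: n x => [|n IHn] x [c cG ->].
  by rewrite big_ord0 multiplicative1 mulgV; apply: mixed_commutator_product1.
rewrite big_ord_recl; set k := c ord0; set y := \prod_(i < n) _.
have Hy : mixed_commutator_product N (2 * n) (y * (t y)^-1).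
  by apply: IHn; exists (fun i => c (lift ord0 i)).
have Hk : mixed_commutator_product N 2 (k * (t k)^-1).
  by rewrite /k; case: (cG ord0) => g _ [h _ <-]; apply: commutator_mod_retract.
have -> : k * y * (t (k * y))^-1 =
    (k * (t k)^-1) * (t k * (y * (t y)^-1) * (t k)^-1).
  by rewrite gmulfM invgM !mulgA mulgVK.
rewrite mulnS; apply: mixed_commutator_productM => //.
exact: mixed_commutator_product_conj.
Qed.

End NormalSet.

Theorem theorem1p5 (N G Gam : groupType)
    (i : {multiplicative N -> G}) (q : {multiplicative G -> Gam})
    (exact_iq : short_exact i q)
    (split_q : exists s : {multiplicative Gam -> G}, cancel s q)
    (abelian_N : forall a b : N, commute a b)
    (x : G) (x_GN : mixed_commutator_subgroup (range i) x) :
  (mixed_cl (range i) x <= 2 * cl x)%N.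
Proof.
case: exact_iq => _ kerq _; case: split_q => s sK.
have kerP g : range i g <-> q g = 1 by rewrite kerq.
have normal_i g y : range i y -> range i (g * y * g^-1).
  by rewrite !kerP !gmulfM multiplicativeV => ->; rewrite mulg1 mulgV.
have group_i : group_closed [in range i].
  split=> [|y z /set_mem/kerP qy /set_mem/kerP qz]; apply/mem_set/kerP.
    exact: multiplicative1.
  by rewrite gmulfM multiplicativeV qy qz mulgV.
have abelian_i a b : range i a -> range i b -> commute a b.
  by move=> [m _ <-] [n _ <-]; rewrite /commute -!gmulfM abelian_N.
(* The kernel of [q] is a subgroup containing all mixed commutators. *)
have qx : q x = 1.
  apply/kerP; apply: x_GN; split=> // y [g _ [z iz <-]]; apply/kerP.
  by move/kerP: iz => qz; rewrite !gmulfM !multiplicativeV qz invg1 !mulg1 mulgV.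
pose t : {multiplicative G -> G} := s \o q.
have retract_t g : range i (g * (t g)^-1).
  by apply/kerP; rewrite gmulfM multiplicativeV /= sK mulgV.
(* Membership of [x] in the mixed commutator subgroup ensures that neither length is the default
   value 0 of [xget]. *)
have [_ minx] := mixed_clP group_i x_GN.
have [clx _] := clP x_GN.
apply: minx.
have := commutator_product_mod_retract _ _ normal_i group_i abelian_i t
  retract_t _ _ clx.
by rewrite /= qx multiplicative1 invg1 mulg1.
Qed.
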